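(* Let $I_H$ be an $L^2$ projection (onto a finite-dimensional space $X^H$ associated with a coarse mesh scale $H$), and let $H>0$, $\chi>0$ and the time step $k>0$ be arbitrary. Let $v^{n+1}$ be obtained from $\widetilde v^{n+1}$ by Step 2A: $$\frac{v^{n+1}-\widetilde v^{n+1}}{k}-\chi I_H\big(u(t^{n+1})-v^{n+1}\big)=0 .$$ Set $e^{n}=u(t^{n})-v^{n}$ and $\widetilde e^{n}=u(t^{n})-\widetilde v^{n}$ (for every $n$). Then $$\tfrac12\|e^{n+1}\|^2-\tfrac12\|\widetilde e^{n+1}\|^2+\tfrac12\|e^{n+1}-\widetilde e^{n+1}\|^2+k\chi\|I_He^{n+1}\|^2=0 .$$ This implies that $\|e^{n+1}\|<\|\widetilde e^{n+1}\|$ unless $v^{n+1}=\widetilde v^{n+1}$. Thus, choosing $T_1=t^n$ and $T_2=t^{n+1}$, Step 2A, having decreased the error at $t^{n+1}$, has decreased the finite time Lyapunov exponent $\lambda(T_1,T_2)$ and has increased the calculated $\varepsilon$-predictability horizon $\tau^{\varepsilon}(T_1,T_2)$, compared to the predictability horizon calculated with Step 2A omitted (that is, with $\widetilde v^{n+1}$ used in place of $v^{n+1}$ as the approximation at $t^{n+1}$).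
   Context: $\|\cdot\|$ is the $L^2(\Omega)$ norm, $\Omega\subset\mathbb R^d$, $d=2$ or $3$. An $L^2$ projection $I_H$ onto $X^H$ is defined by $(u-I_Hu,w^H)=0$ for all $w^H\in X^H$, where $(\cdot,\cdot)$ is the $L^2$ inner product. $u(t)$ is the true velocity (a solution of the incompressible Navier-Stokes equations), $v^n$ is the approximation at $t^n$, $\widetilde v^{n+1}$ is the forecast obtained from $v^n$ by one time step, of length $k=t^{n+1}-t^n$, of a Navier-Stokes time stepping method, and $v^{n+1}$ is the assimilated approximation at $t^{n+1}$. For an approximation $v$ to $u$ and times $T_1<T_2$, the finite time Lyapunov exponent is $\lambda(T_1,T_2)=\frac{1}{T_2-T_1}\ln\left(\frac{\|u(T_2)-v(T_2)\|}{\|u(T_1)-v(T_1)\|}\right)$, and the $\varepsilon$-predictability horizon is $\tau^\varepsilon(T_1,T_2)=\frac1{\lambda(T_1,T_2)}\ln\left(\frac{\varepsilon}{\|u(T_1)-v(T_1)\|}\right)$; here both are taken with the $L^2$ norm.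
   Formalization: The horizon is shown to increase only if ε > ‖e^n‖ > 0 with the new λ ≥ 0 or both exponents negative, or 0 < ε < ‖e^n‖ with new λ < 0 < old λ (negative λ finite); otherwise the claim fails or is undefined, e.g. new λ < 0 < old λ with ε > ‖e^n‖. *)

(* Defs.v *)
From HB Require Import structures.
From mathcomp Require Import all_boot all_order all_algebra.
From mathcomp Require Import all_classical all_reals all_analysis.

Set Implicit Arguments.
Unset Strict Implicit.
Unset Printing Implicit Defensive.
Import Order.TTheory GRing.Theory Num.Theory.
Import numFieldNormedType.Exports.

Local Open Scope classical_set_scope.
Local Open Scope ring_scope.

(* R^d with its Borel sigma-algebra. *)
Notation Rn R d := (d.-tuple (measurableTypeR R)).

Section lebesgue_measure_Rn.
Variable R : realType.

Definition Rn_cons (d : nat) (x : measurableTypeR R * Rn R d) : Rn R d.+1 :=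
  [the d.+1.-tuple (measurableTypeR R) of x.1 :: x.2].

Lemma measurable_Rn_cons (d : nat) : measurable_fun setT (@Rn_cons d).
Proof.
exact: (@measurable_cons _ _ _ _ fst d snd measurable_fst measurable_snd).
Qed.

Section lebesgue_Rn_succ.
Variables (d : nat) (mu : {sigma_finite_measure set (Rn R d) -> \bar R}).

Definition lebesgue_Rn_succ : set (Rn R d.+1) -> \bar R :=
  pushforward (lebesgue_measure \x mu)%E (@Rn_cons d).

HB.instance Definition _ := Measure.copy lebesgue_Rn_succ
  (Measure.clone _ _ _
     (pushforward (lebesgue_measure \x mu)%E (@Rn_cons d))
     (measure_function_pushforward__canonical__measure_function_Measure
       (lebesgue_measure \x mu)%E (@measurable_Rn_cons d))).

Lemma sigma_finite_lebesgue_Rn_succ : sigma_finite setT lebesgue_Rn_succ.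
Proof.
have /sigma_finiteP[F [TF ndF Foo]] := sigma_finiteT (@lebesgue_measure R).
have /sigma_finiteP[G [TG ndG Goo]] := sigma_finiteT mu.
pose hd (y : Rn R d.+1) : measurableTypeR R := tnth y ord0.
pose tl (y : Rn R d.+1) : Rn R d := [tuple of behead y].
have mhd : measurable_fun setT hd by exact: measurable_tnth.
have mtl : measurable_fun setT tl by exact: measurable_behead.
exists (fun i => hd @^-1` F i `&` tl @^-1` G i).
  apply/esym; rewrite -subTset => y _.
  have [n _ Fn] : (\bigcup_i F i) (hd y) by rewrite -TF.
  have [k _ Gk] : (\bigcup_i G i) (tl y) by rewrite -TG.
  exists (maxn n k) => //; split => /=.
    by move: Fn; exact/subsetPset/ndF/leq_maxl.
  by move: Gk; exact/subsetPset/ndG/leq_maxr.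
move=> i; have [mF Fi] := Foo i; have [mG Gi] := Goo i; split.
  apply: measurableI.
    by rewrite -[X in measurable X]setTI; exact: mhd.
  by rewrite -[X in measurable X]setTI; exact: mtl.
rewrite /lebesgue_Rn_succ /pushforward.
rewrite (_ : _ @^-1` _ = F i `*` G i).
  by rewrite product_measure1E// lte_mul_pinfty// ge0_fin_numE.
have hdK a b : hd (Rn_cons (a, b)) = a by [].
have tlK a b : tl (Rn_cons (a, b)) = b by exact/val_inj.
by apply/seteqP; split => -[a b]; rewrite /= hdK tlK.
Qed.

HB.instance Definition _ := Measure_isSigmaFinite.Build _ _ _
  lebesgue_Rn_succ sigma_finite_lebesgue_Rn_succ.

End lebesgue_Rn_succ.

(* The Lebesgue measure on R^d, d-fold product of the one on R. *)
Fixpoint lebesgue_Rn (d : nat) : {sigma_finite_measure set (Rn R d) -> \bar R} :=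
  match d with
  | 0 => [the {sigma_finite_measure set (Rn R 0) -> \bar R}
            of dirac ([tuple] : Rn R 0)]
  | d'.+1 => [the {sigma_finite_measure set (Rn R d'.+1) -> \bar R}
                of lebesgue_Rn_succ (lebesgue_Rn d')]
  end.

End lebesgue_measure_Rn.

Section L2_velocity.
Variables (R : realType) (d : nat) (Om : set (Rn R d)) (mOm : measurable Om).

Definition lebesgue_on : {measure set (Rn R d) -> \bar R} :=
  mrestr (lebesgue_Rn R d) mOm.

(* Vector fields with components in L^2(Om). Elements are functions, not
   classes: equality in L^2 is [L2eq]. They are defined on all of R^d, but the
   measure only sees Om, so their values outside Om are irrelevant. *)
Definition L2field : lmodType R :=
  {ffun 'I_d -> LfunType lebesgue_on (lee1n 2)}.

Definition L2eq (u w : L2field) : Prop :=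
  forall i, (u i : Rn R d -> R) = w i %[ae lebesgue_on].

Definition L2dot (u w : L2field) : R :=
  \sum_(i < d) \int[lebesgue_on]_x (u i x * w i x).

Definition L2norm (u : L2field) : R := Num.sqrt (L2dot u u).

Definition finite_dim_subspace (X : set L2field) : Prop :=
  exists (m : nat) (phi : 'I_m -> L2field),
    X = range (fun c : 'I_m -> R => \sum_(j < m) c j *: phi j).

Definition L2_projection (X : set L2field) (P : L2field -> L2field) : Prop :=
  forall u, X (P u) /\ forall w, X w -> L2dot (u - P u) w = 0.

(* The finite time Lyapunov exponent and the epsilon-predictability horizon of
   an approximation whose errors u(T1) - v(T1), u(T2) - v(T2) are e1, e2.
   They are extended reals, with ln 0 = -oo and 1 / 0 = +oo: the exponent is
   -oo if e2 = 0, and there is no finite horizon if the exponent is 0. They are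
   meant for e1 != 0, since the exponent divides by the norm of e1. *)
Definition lyapunov (T1 T2 : R) (e1 e2 : L2field) : \bar R :=
  (((T2 - T1)^-1)%:E * lne (L2norm e2 / L2norm e1)%:E)%E.

Definition horizon (eps T1 T2 : R) (e1 e2 : L2field) : \bar R :=
  ((lyapunov T1 T2 e1 e2)^-1 * lne (eps / L2norm e1)%:E)%E.

End L2_velocity.

(* Main.v *)
Require Import Defs.
From HB Require Import structures.
From mathcomp Require Import all_boot all_order all_algebra.
From mathcomp Require Import all_classical all_reals all_analysis.
From mathcomp Require Import ring lra.

Set Implicit Arguments.
Unset Strict Implicit.
Unset Printing Implicit Defensive.
Import Order.TTheory GRing.Theory Num.Theory.
Import numFieldNormedType.Exports.

Local Open Scope classical_set_scope.
Local Open Scope ring_scope.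

(** Let [w] be the increment [v n.+1 - vt n.+1], so that the forecast error is [e + w] with [e] the
    analysis error. Step 2A says that [w] is [k * chi] times the projection of [e], almost
    everywhere. Testing it against [e] and using orthogonality of the projection gives
    [L2dot w e = k * chi * L2norm (P e) ^+ 2], and expanding the square of [e + w] yields the energy
    identity ([nudging_energy]). A nonzero [w] then makes the decrease of the error strict
    ([nudging_L2norm_lt]).

    The exponent is a strictly increasing function of the final error. The horizon is the inverse of
    the exponent times a logarithm whose sign depends on whether [eps] exceeds the initial error.
    Inversion reverses order only on each side of 0, hence the sign cases in [horizon_lt_gt] and
    [horizon_lt_lt]. *)

Section L2_inner_product.
Variables (R : realType) (d : nat) (Om : set (Rn R d)) (mOm : measurable Om).
Implicit Types u w z : L2field mOm.

Lemma integrable_L2mul u w i :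
  (lebesgue_on mOm).-integrable setT (EFin \o (fun x => u i x * w i x)).
Proof.
by apply/Lfun1_integrable; apply: Lfun2_mul_Lfun1; exact: LfunP.
Qed.

Lemma L2dotC u w : L2dot u w = L2dot w u.
Proof.
apply: eq_bigr => i _; apply: eq_Rintegral => x _.
by rewrite mulrC.
Qed.

Lemma L2dotDl u w z : L2dot (u + w) z = L2dot u z + L2dot w z.
Proof.
rewrite /L2dot -big_split; apply: eq_bigr => i _ /=.
rewrite -RintegralD//; [|exact: integrable_L2mul..].
by apply: eq_Rintegral => x _; rewrite ffunE /= mulrDl.
Qed.

Lemma L2dotZl a u w : L2dot (a *: u) w = a * L2dot u w.
Proof.
rewrite /L2dot mulr_sumr; apply: eq_bigr => i _.
rewrite -RintegralZl//; last exact: integrable_L2mul.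
by apply: eq_Rintegral => x _; rewrite ffunE /= mulrA.
Qed.

Lemma L2dotBl u w z : L2dot (u - w) z = L2dot u z - L2dot w z.
Proof. by rewrite -scaleN1r L2dotDl L2dotZl mulN1r. Qed.

Lemma L2dotDr u w z : L2dot u (w + z) = L2dot u w + L2dot u z.
Proof. by rewrite L2dotC L2dotDl !(L2dotC u). Qed.

Lemma L2dot_ge0 u : 0 <= L2dot u u.
Proof.
apply: sumr_ge0 => i _; apply: Rintegral_ge0 => x _.
by rewrite -expr2 sqr_ge0.
Qed.

Lemma sqr_L2norm u : L2norm u ^+ 2 = L2dot u u.
Proof. by rewrite sqr_sqrtr// L2dot_ge0. Qed.

Lemma L2norm_ge0 u : 0 <= L2norm u.
Proof. exact: sqrtr_ge0. Qed.

Lemma L2norm_sqrD u w :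
  L2norm (u + w) ^+ 2 = L2norm u ^+ 2 + 2 * L2dot w u + L2norm w ^+ 2.
Proof. by rewrite !sqr_L2norm L2dotDl !L2dotDr (L2dotC u w); ring. Qed.

Lemma L2normN u : L2norm (- u) = L2norm u.
Proof.
by rewrite /L2norm -scaleN1r L2dotZl L2dotC L2dotZl mulrA mulrNN !mul1r.
Qed.

(** Step 2A holds only almost everywhere; this turns it into an exact scalar equation once tested
    against a field. *)
Lemma L2eq0_dot u w : L2eq u 0 -> L2dot u w = 0.
Proof.
move=> u0; apply: big1 => i _.
rewrite /Rintegral (@ae_eq_integral _ _ _ _ _ (cst 0))//.
- by rewrite integral0.
- by case/integrableP: (integrable_L2mul u w i).
- have := u0 i; apply: filterS => x /= ux xT.
  by rewrite ux// ffunE mul0r.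
Qed.

(** A vanishing sum of nonnegative integrals has vanishing terms, and a nonnegative function with
    zero integral is null almost everywhere. *)
Lemma L2dot_eq0 u : L2dot u u = 0 -> L2eq u 0.
Proof.
move=> /eqP; rewrite psumr_eq0; last first.
  by move=> i _; apply: Rintegral_ge0 => x _; rewrite -expr2 sqr_ge0.
move=> /allP uu0 i.
have iu := integrable_L2mul u u i.
have /implyP/(_ isT)/eqP uui := uu0 i (mem_index_enum i).
have /integrableP[mu _] := iu.
have : (\int[lebesgue_on mOm]_x `|(u i x * u i x)%:E| = 0)%E.
  under eq_integral => x _ do rewrite gee0_abs ?lee_fin -?expr2 ?sqr_ge0//.
  (* The real integral is [fine] of the extended one; finiteness is what allows its vanishing to be
     lifted back. *)
  rewrite -[LHS]fineK; last exact: integrable_fin_num.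
  by rewrite -[fine _]/(\int[lebesgue_on mOm]_x (u i x * u i x)) uui.
move/(ae_eq_integral_abs _ measurableT mu); apply: filterS => x /= ux xT.
move: (ux xT) => [] /eqP; rewrite mulf_eq0 orbb => /eqP ->.
by rewrite ffunE.
Qed.

Lemma L2eqP u w : L2eq u w <-> L2eq (u - w) 0.
Proof.
by split=> uw i; have := uw i; apply: filterS => x /= ux xT;
  move: (ux xT); rewrite !ffunE /= => /eqP; [rewrite -subr_eq0|rewrite subr_eq0];
  move/eqP.
Qed.

Lemma L2norm_sub_gt0 u w : ~ L2eq u w -> 0 < L2norm (u - w).
Proof.
move=> uw; rewrite lt0r L2norm_ge0 andbT; apply/eqP => n0; apply: uw.
by apply/L2eqP/L2dot_eq0; rewrite -sqr_L2norm n0 expr0n.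
Qed.

(** The residual [u - P u] is orthogonal to [X], which contains [P u]. *)
Lemma L2_projection_dot (X : set (L2field mOm)) P u :
  L2_projection X P -> L2dot (P u) u = L2norm (P u) ^+ 2.
Proof.
move=> /(_ u)[XPu /(_ _ XPu)/eqP].
by rewrite L2dotBl subr_eq0 sqr_L2norm L2dotC => /eqP.
Qed.

(* Test the nudging equation against the analysis error [e]: [e + w] is the
   forecast error, since the increment [w] is analysis minus forecast. *)
Lemma nudging_energy (X : set (L2field mOm)) P (a k : R) e w :
  L2_projection X P -> k != 0 -> L2eq (k^-1 *: w - a *: P e) 0 ->
  2^-1 * L2norm e ^+ 2 - 2^-1 * L2norm (e + w) ^+ 2
    + 2^-1 * L2norm w ^+ 2 + k * a * L2norm (P e) ^+ 2 = 0.
Proof.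
move=> XP k0 /(@L2eq0_dot _ e)/eqP.
rewrite L2dotBl !L2dotZl (L2_projection_dot _ XP) subr_eq0 => /eqP we.
have {}we : L2dot w e = k * a * L2norm (P e) ^+ 2.
  by rewrite -mulrA -we mulVKf.
by rewrite L2norm_sqrD we; field.
Qed.

(** In the energy identity the projection term is nonnegative and the increment term is positive. *)
Lemma nudging_L2norm_lt (X : set (L2field mOm)) P (a k : R) e w :
  L2_projection X P -> 0 < a -> 0 < k -> L2eq (k^-1 *: w - a *: P e) 0 ->
  0 < L2norm w -> L2norm e < L2norm (e + w).
Proof.
move=> XP a0 k0 step w0.
have := nudging_energy XP (lt0r_neq0 k0) step.
have : 0 <= k * a * L2norm (P e) ^+ 2.
  by rewrite mulr_ge0 ?sqr_ge0// mulr_ge0// ltW.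
have : 0 < L2norm w ^+ 2 by rewrite exprn_gt0.
move: (L2norm_ge0 e) (L2norm_ge0 (e + w)).
move: (L2norm e) (L2norm (e + w)) => x y x0 y0 ? ? energy.
have : x ^+ 2 < y ^+ 2 by lra.
by rewrite ltr_pXn2r.
Qed.

End L2_inner_product.

Section lyapunov_horizon.
Context {R : realType}.
Local Open Scope ereal_scope.

(** Strictness survives at both ends because [0^-1] is [+oo] and the inverse of [+oo] is 0. *)
Lemma ge0_lte_inve (x y : \bar R) : 0 <= x -> x < y -> y^-1 < x^-1.
Proof.
case: x y => [x| |] [y| |]//=; rewrite ?lee_fin ?lte_fin => x0 xy.
  rewrite !inver (gt_eqF (le_lt_trans x0 xy)).
  have [_|x1] := eqVneq x 0%R; first exact: ltry.
  have {}x0 : (0 < x)%R by rewrite lt0r x1.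
  by rewrite lte_fin ltf_pV2// posrE (lt_trans x0).
rewrite invey inver; have [_|x1] := eqVneq x 0%R; first exact: ltry.
by rewrite lte_fin invr_gt0 lt0r x1.
Qed.

Lemma lt0_lte_inve (x y : \bar R) : -oo < x -> x < y -> y < 0 -> y^-1 < x^-1.
Proof.
case: x y => [x| |] [y| |]//=; rewrite !lte_fin => _ xy y0.
by rewrite !inver !lt_eqF ?(lt_trans xy)// lte_fin ltf_nV2// negrE (lt_trans xy).
Qed.

Variables (d : nat) (Om : set (Rn R d)) (mOm : measurable Om).
Variables (T1 T2 : R) (e1 e2 f2 : L2field mOm).
Hypotheses (e1_gt0 : (0 < L2norm e1)%R) (e2f2 : (L2norm e2 < L2norm f2)%R).
Hypothesis T12 : (T1 < T2)%R.

Lemma lyapunov_lt : lyapunov T1 T2 e1 e2 < lyapunov T1 T2 e1 f2.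
Proof.
rewrite /lyapunov lte_pmul2l ?lte_fin ?invr_gt0 ?subr_gt0//.
have e1V : (0 < (L2norm e1)^-1)%R by rewrite invr_gt0.
(* [lne] is strictly increasing on all of [[0, +oo]], so a zero final error, with exponent [-oo], is
   covered. *)
rewrite lte_lne ?lte_fin ?ltr_pM2r// in_itv/= leey andbT lee_fin;
  by rewrite mulr_ge0// ?L2norm_ge0// ltW.
Qed.

(** Here the logarithm is positive, so the horizons compare as the inverse exponents do, provided
    the exponents do not straddle 0. *)
Lemma horizon_lt_gt (eps : R) : (L2norm e1 < eps)%R ->
  0 <= lyapunov T1 T2 e1 e2 \/
    (-oo < lyapunov T1 T2 e1 e2 /\ lyapunov T1 T2 e1 f2 < 0) ->
  horizon eps T1 T2 e1 f2 < horizon eps T1 T2 e1 e2.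
Proof.
move=> eps1 lam; have eps0 : (0 < eps)%R by exact: lt_trans eps1.
rewrite /horizon lne_EFin ?divr_gt0// lte_pmul2r//; last first.
  by rewrite lte_fin ln_gt0// ltr_pdivlMr// mul1r.
case: lam => [lam|[lam lamt]]; first exact: ge0_lte_inve lyapunov_lt.
exact: lt0_lte_inve lyapunov_lt lamt.
Qed.

(** Here the logarithm is negative and the exponents have opposite signs, so 0 separates the two
    horizons. *)
Lemma horizon_lt_lt (eps : R) : (0 < eps < L2norm e1)%R ->
  -oo < lyapunov T1 T2 e1 e2 < 0 -> 0 < lyapunov T1 T2 e1 f2 ->
  horizon eps T1 T2 e1 f2 < horizon eps T1 T2 e1 e2.
Proof.
move=> /andP[eps0 eps1] /andP[_ lam] lamt.
have L0 : (ln (eps / L2norm e1) < 0)%R.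
  by rewrite ln_lt0// divr_gt0//= ltr_pdivrMr// mul1r.
(* An infinite exponent would have inverse 0 and the horizon would not be strictly negative. *)
have lamtN : lyapunov T1 T2 e1 f2 != +oo.
  rewrite /lyapunov lne_EFin ?divr_gt0//.
  exact: le_lt_trans (L2norm_ge0 _) e2f2.
rewrite /horizon lne_EFin ?divr_gt0//; apply: (@lt_trans _ _ 0).
  by apply: mule_gt0_lt0; rewrite ?lte_fin// inve_gt0// gt_eqF.
by apply: mule_lt0_lt0; rewrite ?lte_fin// inve_lt0.
Qed.

End lyapunov_horizon.

Theorem mainTheorem2 (R : realType)
    (d : nat) (hd : d = 2%N \/ d = 3%N)
    (Om : set (Rn R d)) (mOm : measurable Om)
    (X : R -> set (L2field mOm)) (I : R -> L2field mOm -> L2field mOm)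
    (hX : forall H : R, 0 < H -> finite_dim_subspace (X H))
    (hI : forall H : R, 0 < H -> L2_projection (X H) (I H))
    (u : R -> L2field mOm) (t : nat -> R) (v vt : nat -> L2field mOm)
    (n : nat) (H chi k : R)
    (hH : 0 < H) (hchi : 0 < chi) (hk : 0 < k) (ht : k = t n.+1 - t n)
    (step2A : L2eq (k^-1 *: (v n.+1 - vt n.+1)
                    - chi *: I H (u (t n.+1) - v n.+1)) 0) :
  let e := fun m => u (t m) - v m in
  let et := fun m => u (t m) - vt m in
  let lam := lyapunov (t n) (t n.+1) (e n) (e n.+1) in
  let lamt := lyapunov (t n) (t n.+1) (e n) (et n.+1) in
  let tau := fun eps => horizon eps (t n) (t n.+1) (e n) (e n.+1) in
  let taut := fun eps => horizon eps (t n) (t n.+1) (e n) (et n.+1) in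
  [/\ 2^-1 * L2norm (e n.+1) ^+ 2 - 2^-1 * L2norm (et n.+1) ^+ 2
        + 2^-1 * L2norm (e n.+1 - et n.+1) ^+ 2
        + k * chi * L2norm (I H (e n.+1)) ^+ 2 = 0,
      ~ L2eq (v n.+1) (vt n.+1) -> L2norm (e n.+1) < L2norm (et n.+1)
    & ~ L2eq (v n.+1) (vt n.+1) -> 0 < L2norm (e n) ->
      [/\ (lam < lamt)%E,
          forall eps : R, L2norm (e n) < eps ->
            (0 <= lam)%E \/ (-oo < lam /\ lamt < 0)%E ->
            (taut eps < tau eps)%E
        & forall eps : R, 0 < eps < L2norm (e n) ->
            (-oo < lam < 0)%E -> (0 < lamt)%E ->
            (taut eps < tau eps)%E]].
Proof.
move=> e et lam lamt tau taut.
have t12 : t n < t n.+1 by rewrite -subr_gt0 -ht.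
(* This puts the forecast error in the form [e + w] of the nudging lemmas. *)
have etE : et n.+1 = e n.+1 + (v n.+1 - vt n.+1).
  by rewrite /et /e addrA subrK.
have wE : L2norm (e n.+1 - et n.+1) = L2norm (v n.+1 - vt n.+1).
  by rewrite etE opprD addrA subrr add0r L2normN.
have XP := hI H hH.
have err : ~ L2eq (v n.+1) (vt n.+1) -> L2norm (e n.+1) < L2norm (et n.+1).
  by move=> /L2norm_sub_gt0; rewrite etE; exact: nudging_L2norm_lt step2A.
split; last first.
- move=> /err {}err e0; split=> [|eps|eps]; first exact: lyapunov_lt.
    exact: horizon_lt_gt.
  exact: horizon_lt_lt.
- exact: err.
- by rewrite wE etE; exact: nudging_energy (lt0r_neq0 hk) step2A.
Qed.
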